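(* For any QP $(Q,S)$ and any QP-representation $\mathcal{M}=(M,V)$ of $(Q,S)$, let $\mathcal{M}^\star=(M^\star,V)$ be the dual QP-representation of the opposite QP $(Q^{\rm op},S^{\rm op})$. Then $E(\mathcal{M}^\star)=E(\mathcal{M})$.
   Context: **Quivers with potentials (QPs).** Vector spaces are over $\mathbb{C}$. A quiver $Q=(Q_0,Q_1,h,t)$ has finite vertex set $Q_0=\{1,\dots,n\}$, finite arrow set $Q_1$, no loops; an arrow $a$ goes from its tail $t(a)$ to its head $h(a)$. $R=\bigoplus_i\mathbb{C}e_i$ with $e_ie_j=\delta_{ij}e_i$; $A$ is the $R$-bimodule with basis $Q_1$, $e_iAe_j$ being spanned by the arrows $j\to i$; $R\langle\langle A\rangle\rangle=\prod_{d\ge0}A^{\otimes_R d}$ (paths written right to left) with the $\mathfrak{m}$-adic topology, $\mathfrak{m}=\prod_{d\ge1}A^{\otimes_R d}$. A potential $S$ is a possibly infinite linear combination of cyclic paths of positive length, up to cyclic equivalence ($S\sim S'$ if $S-S'$ lies in the closure of the span of all $a_1\cdots a_d-a_2\cdots a_da_1$, $a_1\cdots a_d$ cyclic). Cyclic derivatives are the continuous linear maps with $\partial_a(a_1\cdots a_d)=\sum_{p:a_p=a}a_{p+1}\cdots a_da_1\cdots a_{p-1}$; $J(S)$ is the closure of the two-sided ideal generated by all $\partial_aS$; $\mathcal{P}(Q,S)=R\langle\langle A\rangle\rangle/J(S)$. For arrows $a,b$ with $h(a)=t(b)$, $\partial_{ba}S$ is defined by replacing $S$ by a cyclically equivalent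 potential in which no occurring cyclic path $a_1\cdots a_d$ has $a_1=a$ and then setting $\partial_{ba}(a_1\cdots a_d)=\sum_{\nu:a_{\nu-1}=b,a_\nu=a}a_{\nu+1}\cdots a_da_1\cdots a_{\nu-2}$ (extended linearly and continuously). **QP-representations.** A QP-representation of $(Q,S)$ is $\mathcal{M}=(M,V)$ with $M$ a finite-dimensional $\mathcal{P}(Q,S)$-module (spaces $M(i)$ and maps $a_M:M(t(a))\to M(h(a))$, annihilated by all sufficiently long paths and all $\partial_aS$) and $V=(V(i))_{i\in Q_0}$ a family of finite-dimensional vector spaces. For $k\in Q_0$ put $M_{\rm in}(k)=\bigoplus_{h(a)=k}M(t(a))$, $M_{\rm out}(k)=\bigoplus_{t(b)=k}M(h(b))$; $\gamma_k:M_{\rm out}(k)\to M_{\rm in}(k)$ is the map with components $(\partial_{ba}S)_M:M(h(b))\to M(t(a))$ for $h(a)=t(b)=k$. The $E$-invariant is $E(\mathcal{M})=\dim\mathrm{Hom}_Q(M,M)+\sum_{k=1}^n g_k\dim M(k)$, where $g_k=\dim\ker\gamma_k-\dim M(k)+\dim V(k)$ and $\mathrm{Hom}_Q$ denotes homomorphisms of quiver representations. **Opposite QP and dual representation.** $Q^{\rm op}$ is obtained from $Q$ by reversing all arrows; $a^{\rm op}$ is the arrow of $Q^{\rm op}$ corresponding to $a$. The map $a\mapsto a^{\rm op}$ extends to a (continuous) anti-isomorphism $u\mapsto u^{\rm op}$ of complete path algebras, identical on $R$; $(Q^{\rm op},S^{\rm op})$ is the opposite QP. $\mathcal{M}^\star=(M^\star,V)$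 is the QP-representation of $(Q^{\rm op},S^{\rm op})$ with $M^\star(k)=M(k)^\star$ (dual space) and $(a^{\rm op})_{M^\star}=(a_M)^\star$ for every arrow $a$. *)

(* Defs.v *)
From HB Require Import structures.
From mathcomp Require Import all_boot all_order all_algebra.
From mathcomp Require Import mathcomp_extra boolp classical_sets functions.
From mathcomp Require Import cardinality fsbigop reals complex zify.

Set Implicit Arguments.
Unset Strict Implicit.
Unset Printing Implicit Defensive.

Import GRing.Theory.
Local Open Scope ring_scope.

Definition dsum (K : fieldType) (I : finType) (T : I -> vectType K) : Type :=
  {dffun forall i : I, T i}.

Section DirectSum.
Import VectorInternalTheory.
Variables (K : fieldType) (I : finType) (T : I -> vectType K).
Local Notation D := (dsum T).

HB.instance Definition _ := Choice.copy D {dffun forall i : I, T i}.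

Definition dsum_fun (x : D) : forall i, T i := x.
Definition mk_dsum (f : forall i, T i) : D := finfun f.

Lemma mk_dsumE f i : dsum_fun (mk_dsum f) i = f i.
Proof. by rewrite /dsum_fun /mk_dsum ffunE. Qed.

Lemma dsumP (x y : D) : (forall i, dsum_fun x i = dsum_fun y i) -> x = y.
Proof. by move=> h; apply/ffunP. Qed.

Definition dsum_zero : D := mk_dsum (fun=> 0).
Definition dsum_opp (x : D) : D := mk_dsum (fun i => - dsum_fun x i).
Definition dsum_add (x y : D) : D :=
  mk_dsum (fun i => dsum_fun x i + dsum_fun y i).
Definition dsum_scale (c : K) (x : D) : D := mk_dsum (fun i => c *: dsum_fun x i).

Fact dsum_addA : associative dsum_add.
Proof. by move=> x y z; apply/dsumP => i; rewrite !mk_dsumE addrA. Qed.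
Fact dsum_addC : commutative dsum_add.
Proof. by move=> x y; apply/dsumP => i; rewrite !mk_dsumE addrC. Qed.
Fact dsum_add0 : left_id dsum_zero dsum_add.
Proof. by move=> x; apply/dsumP => i; rewrite !mk_dsumE add0r. Qed.
Fact dsum_addN : left_inverse dsum_zero dsum_opp dsum_add.
Proof. by move=> x; apply/dsumP => i; rewrite !mk_dsumE addNr. Qed.

HB.instance Definition _ :=
  GRing.isZmodule.Build D dsum_addA dsum_addC dsum_add0 dsum_addN.

Lemma dsum_funD (x y : D) i : dsum_fun (x + y) i = dsum_fun x i + dsum_fun y i.
Proof. exact: mk_dsumE. Qed.

Fact dsum_scaleA a b x : dsum_scale a (dsum_scale b x) = dsum_scale (a * b) x.
Proof. by apply/dsumP => i; rewrite !mk_dsumE scalerA. Qed.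
Fact dsum_scale1 : left_id 1 dsum_scale.
Proof. by move=> x; apply/dsumP => i; rewrite !mk_dsumE scale1r. Qed.
Fact dsum_scaleDr : right_distributive dsum_scale +%R.
Proof.
by move=> c x y; apply/dsumP => i; rewrite !(mk_dsumE, dsum_funD) scalerDr.
Qed.
Fact dsum_scaleDl x : {morph dsum_scale^~ x : a b / a + b}.
Proof.
by move=> a b; apply/dsumP => i; rewrite !(mk_dsumE, dsum_funD) scalerDl.
Qed.

HB.instance Definition _ := GRing.Zmodule_isLmodule.Build K D
  dsum_scaleA dsum_scale1 dsum_scaleDr dsum_scaleDl.

Lemma dsum_funZ c (x : D) i : dsum_fun (c *: x) i = c *: dsum_fun x i.
Proof. exact: mk_dsumE. Qed.
Lemma dsum_fun0 i : dsum_fun (0 : D) i = 0.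
Proof. exact: mk_dsumE. Qed.

Lemma dsum_linear (U : lmodType K) (f : U -> D) :
  (forall c x y i, dsum_fun (f (c *: x + y)) i
                   = c *: dsum_fun (f x) i + dsum_fun (f y) i) -> linear f.
Proof.
move=> h c x y; apply/dsumP => i; rewrite h.
by rewrite -[in LHS]dsum_funZ -[in LHS]dsum_funD.
Qed.

Lemma dsum_fun_linear i : linear (fun x : D => dsum_fun x i).
Proof. by move=> c x y; rewrite -dsum_funZ -dsum_funD. Qed.

Let off (i : I) := dim (T i).

Fact dsum_vect_iso : Vector.axiom (\sum_(k < #|I|) off (enum_val k)) D.
Proof.
pose toR (x : D) : 'rV[K]_(\sum_(k < #|I|) off (enum_val k)) :=
  \mxrow_k v2r (dsum_fun x (enum_val k)).
pose ofR (r : 'rV[K]_(\sum_(k < #|I|) off (enum_val k))) : D := mk_dsum (fun i =>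
  @r2v _ (T i) (castmx (erefl _, congr1 off (enum_rankK i)) (submxrow r (enum_rank i)))).
exists toR.
  move=> c x y; apply/mxrowP => k; rewrite mxrowK submxrowD mxrowK.
  rewrite dsum_funD dsum_funZ linearP.
  have -> : submxrow (c *: toR x) k = c *: submxrow (toR x) k.
    by apply/matrixP => i j; rewrite !mxE.
  by rewrite mxrowK.
exists ofR.
  move=> x; apply/dsumP => i; rewrite mk_dsumE mxrowK.
  have cast_r2v j (e : j = i) :
      @r2v _ (T i) (castmx (erefl _, congr1 off e) (v2r (dsum_fun x j)))
      = dsum_fun x i by case: _ / e; rewrite castmx_id v2rK.
  exact: cast_r2v.
move=> r; apply/mxrowP => k; rewrite mxrowK mk_dsumE r2vK.
set e := congr1 _ _; move: e; rewrite enum_valK => e.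
by rewrite (eq_axiomK e) castmx_id.
Qed.

HB.instance Definition _ := Lmodule_hasFinDim.Build K D dsum_vect_iso.

End DirectSum.

Definition hom_space (K : fieldType) (V W : vectType K) : vectType K :=
  Vector.clone K 'Hom(V, W) _.

Record quiver := Quiver {
  nvert : nat;
  arrow : finType;
  hd : arrow -> 'I_nvert;
  tl : arrow -> 'I_nvert;
  no_loop : forall a, hd a != tl a }.

Arguments hd {q}.
Arguments tl {q}.

(* The word [:: a_1; ...; a_d] stands for the product a_1 ... a_d, paths being
   written from right to left: it is a path iff tl a_p = hd a_(p+1) for all p.
   A cyclic path moreover satisfies tl a_d = hd a_1 and d > 0. *)
Definition composable (Q : quiver) : rel (arrow Q) := fun a b => tl a == hd b.
Definition cyclic_path (Q : quiver) (w : seq (arrow Q)) : bool :=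
  (w != [::]) && cycle (@composable Q) w.

(* An element of the completed path algebra is given by its coefficients on
   words; the empty word stands for 1 = \sum_i e_i, and a word that is not a
   path is zero in the algebra.  A component e_j u e_i is thus determined by the
   coefficients of the paths from i to j, the empty word giving e_i if i = j. *)
Definition series (K : fieldType) (Q : quiver) := seq (arrow Q) -> K.

(* A representative of a class for the relation cyc_equiv below; cyc_der and
   cyc_der2 only depend on this class. *)
Record potential (K : fieldType) (Q : quiver) := Potential {
  pot_coef :> seq (arrow Q) -> K;
  pot_cyclic : forall w, pot_coef w != 0 -> cyclic_path w }.

Section Series.
Variables (K : fieldType) (Q : quiver).
Implicit Types (S T : series K Q) (a b : arrow Q) (v w : seq (arrow Q)).

(* S - T is in the closure of the span of the a_1 ... a_d - a_2 ... a_d a_1. *)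
Definition cyc_equiv S T : Prop :=
  forall N : nat, exists l : seq (K * seq (arrow Q)),
    all (fun cu => cyclic_path cu.2) l /\
    forall w, (size w < N)%N ->
      S w - T w =
        \sum_(cu <- l) cu.1 * ((w == cu.2)%:R - (w == rot 1 cu.2)%:R).

(* Continuous linear extension of a map sending each word w to the sum of the
   words listed in D w.  The maps D below remove a fixed number of letters, so
   that only finitely many words w contribute to each coefficient. *)
Definition lin_ext (D : seq (arrow Q) -> seq (seq (arrow Q))) S : series K Q :=
  fun v => \sum_(w \in [set: seq (arrow Q)]) S w *+ count_mem v (D w).

(* With 0-based positions, drop p.+1 w ++ take p w is the word
   a_(p+1) ... a_d a_1 ... a_(p-1) of the usual 1-based notation. *)
Definition cyc_der_word a w : seq (seq (arrow Q)) :=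
  [seq drop p.+1 w ++ take p w | p <- iota 0 (size w) & onth w p == Some a].
Definition cyc_der a S : series K Q := lin_ext (cyc_der_word a) S.

(* Replaces every cyclic path a_1 ... a_d with a_1 = a by a_2 ... a_d a_1. *)
Definition rot_off_word a w : seq (seq (arrow Q)) :=
  [:: if ohead w == Some a then rot 1 w else w].
Definition rot_off a S : series K Q := lin_ext (rot_off_word a) S.

(* One word a_(v+1) ... a_d a_1 ... a_(v-2) for each v >= 2 with a_(v-1) = b and
   a_v = a; an occurrence with a_d = b and a_1 = a is not counted. *)
Definition cyc_der2_word b a w : seq (seq (arrow Q)) :=
  [seq drop p.+2 w ++ take p w
     | p <- iota 0 (size w) & (onth w p == Some b) && (onth w p.+1 == Some a)].
Definition cyc_der2_raw b a S : series K Q := lin_ext (cyc_der2_word b a) S.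
(* S is first replaced by the cyclically equivalent potential rot_off a S, which
   has no path starting with a (see rot_off_cyc_equiv and rot_off_supp); any
   other such replacement gives the same result (see cyc_der2E). *)
Definition cyc_der2 b a S : series K Q := cyc_der2_raw b a (rot_off a S).

Lemma sum_tuple_eq n (c : seq (arrow Q) -> nat) v :
  \sum_(w : n.-tuple (arrow Q)) (val w == v)%:R *+ c (val w)
  = (size v == n)%:R *+ c v :> K.
Proof.
have [/eqP sv|sv] := boolP (size v == n); last first.
  rewrite mul0rn big1 // => w _; case: eqP => [e|_]; last by rewrite mul0rn.
  by rewrite -e size_tuple eqxx in sv.
rewrite (bigD1 (Tuple (introT eqP sv))) //= eqxx big1 ?addr0 // => w.
by rewrite -val_eqE /= => /negPf ->; rewrite mul0rn.
Qed.

Lemma lin_extE (D : seq (arrow Q) -> seq (seq (arrow Q))) m S v :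
  (forall w u, u \in D w -> size w = (size u + m)%N) ->
  lin_ext D S v = \sum_(w : (size v + m).-tuple (arrow Q))
                     S (val w) *+ count_mem v (D (val w)).
Proof.
move=> hD; pose r := [seq val w | w : (size v + m).-tuple (arrow Q)].
have ur : uniq r by rewrite map_inj_uniq ?enum_uniq //; apply: val_inj.
rewrite /lin_ext -(@fsbig_widen _ _ _ _ [set` r]) => //; last first.
  move=> w [_ /= wr]; rewrite (count_memPn _) ?mulr0n //.
  apply/negP => /hD sw; apply: wr.
  by apply/mapP; exists (Tuple (introT eqP sw)); rewrite ?mem_enum.
by rewrite -fsbig_seq // big_map big_enum.
Qed.

Lemma lin_ext_cyc_equiv (D : seq (arrow Q) -> seq (seq (arrow Q))) m S T v :
  (forall w u, u \in D w -> size w = (size u + m)%N) ->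
  (forall w, perm_eq (D (rot 1 w)) (D w)) ->
  cyc_equiv S T -> lin_ext D S v = lin_ext D T v.
Proof.
move=> hD hrot /(_ (size v + m).+1)[l [_ hl]].
apply/eqP; rewrite -subr_eq0 !(lin_extE _ _ hD) -sumrB; apply/eqP.
under eq_bigr => w _ do rewrite -mulrnBl hl ?size_tuple // -sumrMnl.
rewrite exchange_big big1 // => cu _ /=.
under eq_bigr => w _ do rewrite -mulrnAr mulrnBl.
rewrite -mulr_sumr sumrB !(@sum_tuple_eq _ (fun w => count_mem v (D w))).
by rewrite size_rot (permP (hrot _)) subrr mulr0.
Qed.

Lemma size_cyc_der_word a w u : u \in cyc_der_word a w -> size w = (size u + 1)%N.
Proof.
case/mapP => p; rewrite mem_filter mem_iota /= add0n => /andP[_ pw] ->.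
rewrite size_cat size_drop size_take pw; lia.
Qed.

Lemma drop_cat_le n (w1 w2 : seq (arrow Q)) :
  (n <= size w1)%N -> drop n (w1 ++ w2) = drop n w1 ++ w2.
Proof.
move=> h; rewrite drop_cat; case: ltnP => // h'.
have -> : n = size w1 by lia.
by rewrite subnn drop0 drop_size.
Qed.

Lemma rot_cyc_der_word a w : perm_eq (cyc_der_word a (rot 1 w)) (cyc_der_word a w).
Proof.
case: w => // x s; rewrite rot1_cons.
pose A := [seq drop p.+1 s ++ x :: take p s
             | p <- iota 0 (size s) & onth s p == Some a].
pose B := if Some x == Some a then [:: s] else [::].
have -> : cyc_der_word a (x :: s) = B ++ A.
  rewrite /cyc_der_word.
  have -> : iota 0 (size (x :: s)) = [:: 0%N] ++ map (addn 1) (iota 0 (size s)).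
    by rewrite -(iotaDl 1 0).
  rewrite filter_cat map_cat filter_map -map_comp; congr (_ ++ _).
  by rewrite /B /=; case: ifP => //= _; rewrite drop0 cats0.
suff -> : cyc_der_word a (rcons s x) = A ++ B by rewrite perm_catC.
rewrite /cyc_der_word size_rcons -addn1 iotaD add0n filter_cat map_cat.
congr (_ ++ _); last first.
  rewrite /= -cats1 onth_cat ltnn subnn /= /B; case: ifP => //= _.
  by rewrite drop_oversize ?take_size_cat // size_cat addn1.
have -> : [seq p <- iota 0 (size s) | onth (rcons s x) p == Some a]
   = [seq p <- iota 0 (size s) | onth s p == Some a].
  apply: eq_in_filter => p; rewrite mem_iota add0n /= => ps.
  by rewrite -cats1 onth_cat ps.
apply/eq_in_map => p; rewrite mem_filter mem_iota add0n => /and3P[_ _ ps].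
by rewrite -cats1 take_cat ps drop_cat_le // -catA.
Qed.

Lemma cyc_equiv_sym S T : cyc_equiv S T -> cyc_equiv T S.
Proof.
move=> h N; have [l [cl hl]] := h N.
exists [seq (- cu.1, cu.2) | cu <- l]; split; first by rewrite all_map.
move=> w /hl e; rewrite big_map -opprB e -sumrN.
by apply: eq_bigr => cu _; rewrite mulNr.
Qed.

Lemma cyc_equiv_trans S T U : cyc_equiv S T -> cyc_equiv T U -> cyc_equiv S U.
Proof.
move=> h h' N; have [l [cl hl]] := h N; have [l' [cl' hl']] := h' N.
exists (l ++ l'); rewrite all_cat cl cl'; split=> // w wN.
by rewrite big_cat -hl // -hl' //= addrA subrK.
Qed.

Lemma cyc_der_cyc_equiv a S T : cyc_equiv S T -> cyc_der a S =1 cyc_der a T.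
Proof.
move=> h v; apply: (lin_ext_cyc_equiv _ _ _ h); first exact: size_cyc_der_word.
exact: rot_cyc_der_word.
Qed.

Lemma rot_offE a S v : rot_off a S v =
  \sum_(w : (size v).-tuple (arrow Q))
     S (val w) * (v == (if ohead (val w) == Some a then rot 1 w else w))%:R.
Proof.
rewrite /rot_off (@lin_extE _ 0) => [|w u]; rewrite ?addn0.
  by apply: eq_bigr => w _; rewrite /= addn0 mulr_natr eq_sym.
by rewrite inE => /eqP ->; case: ifP; rewrite ?size_rot.
Qed.

Lemma rot_off_cyc_equiv a (S : potential K Q) : cyc_equiv S (rot_off a S).
Proof.
move=> N; pose r n := [seq val w | w : n.-tuple (arrow Q)].
pose P w := (S w != 0) && (ohead w == Some a).
exists (flatten [seq [seq (S w, w) | w <- r n & P w] | n <- iota 0 N]); split.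
  apply/allP => cu /flatten_mapP[n _ /mapP[w]].
  by rewrite mem_filter => /andP[/andP[/(pot_cyclic) h _] _ ->].
move=> v vN; rewrite big_flatten big_map.
under eq_bigr => n _ do rewrite big_map big_filter big_map.
rewrite (bigD1_seq (size v)) ?mem_iota ?iota_uniq //= [X in _ = _ + X]big1 ?addr0.
  rewrite rot_offE big_enum_cond /=.
  have {1}-> : S v = \sum_(w : (size v).-tuple (arrow Q)) S (val w) * (v == val w)%:R.
    rewrite (bigD1 (in_tuple v)) //= eqxx mulr1 big1 ?addr0 // => w.
    by rewrite -val_eqE /= eq_sym => /negPf ->; rewrite mulr0.
  rewrite -sumrB [RHS]big_mkcond /=; apply: eq_bigr => w _; rewrite -mulrBr /P.
  have [->|_] /= := eqVneq (S w) 0; first by rewrite mul0r.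
  by case: ifP => // _; rewrite subrr mulr0.
move=> n nv; rewrite big1 // => w _.
have neq u : size u = n -> (v == u) = false.
  by move=> su; apply/eqP => e; rewrite -su -e eqxx in nv.
by rewrite !neq ?size_rot ?size_tuple // subrr mulr0.
Qed.

Lemma rot1_head a w : cyclic_path w -> ohead w = Some a ->
  cyclic_path (rot 1 w) && (ohead (rot 1 w) != Some a).
Proof.
case: w => // x s Su [xa]; subst x.
move: Su; rewrite /cyclic_path rot_cycle -!size_eq0 size_rot /= => cs.
rewrite cs rot1_cons; case: s cs => [|y s] /=; rewrite /composable.
  by rewrite andbT eq_sym => h; rewrite (negPf (no_loop a)) in h.
move=> /andP[/eqP h _]; apply: contraNneq (no_loop a) => -[ya].
by rewrite h ya.
Qed.

Lemma rot_off_supp a (S : potential K Q) w :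
  rot_off a S w != 0 -> cyclic_path w && (ohead w != Some a).
Proof.
apply: contraNT => hw; rewrite rot_offE big1 // => u _.
have [-> |/pot_cyclic Su] := eqVneq (S u) 0; first by rewrite mul0r.
case: eqP => [e|_]; last by rewrite mulr0.
case/negP: hw; rewrite {}e.
case: ifP => [/eqP ua|->]; last by rewrite Su.
exact: rot1_head.
Qed.

Definition cyc2_word b a w : seq (seq (arrow Q)) :=
  [seq drop 2 r | r <- [seq rot p w | p <- iota 0 (size w)] & take 2 r == [:: b; a]].

Lemma rot_cyc2_word b a w : perm_eq (cyc2_word b a (rot 1 w)) (cyc2_word b a w).
Proof.
apply/perm_map/perm_filter; rewrite size_rot.
have -> : [seq rot p (rot 1 w) | p <- iota 0 (size w)]
        = [seq rot p w | p <- iota 1 (size w)].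
  rewrite (iotaDl 1 0) -map_comp; apply/eq_in_map => p.
  by rewrite mem_iota /= add0n => pw; rewrite -rotD ?addn1 // add1n.
have e : rot 0 w = rot (size w) w by rewrite rot0 rot_size.
case: (size w) e => // m e.
have -> : iota 1 m.+1 = iota 1 m ++ [:: m.+1] by rewrite -[in LHS](addn1 m) iotaD.
by rewrite map_cat perm_catC /= e.
Qed.

Lemma size_cyc2_word b a w u : u \in cyc2_word b a w -> size w = (size u + 2)%N.
Proof.
case/mapP => r; rewrite mem_filter => /andP[/eqP t2 /mapP[p _ rE]] ->.
by rewrite -(size_rot p w) -rE -{1}(cat_take_drop 2 r) size_cat t2 addnC.
Qed.

Lemma size_cyc_der2_word b a w u :
  u \in cyc_der2_word b a w -> size w = (size u + 2)%N.
Proof.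
case/mapP => p; rewrite mem_filter mem_iota add0n => /andP[/andP[_ h] /andP[_ pw]] ->.
have : isSome (onth w p.+1) by move/eqP: h => ->.
by rewrite onthTE size_cat size_drop size_take pw => h2; rewrite -addnA addn2 subnK.
Qed.

Lemma cyc2_wordE b a w :
  ohead w != Some a -> cyc2_word b a w = cyc_der2_word b a w.
Proof.
move=> hw; rewrite /cyc2_word /cyc_der2_word filter_map -map_comp.
have eP p : (p < size w)%N -> (take 2 (rot p w) == [:: b; a])
    = (onth w p == Some b) && (onth w p.+1 == Some a).
  move=> pw; rewrite /rot.
  have onthD q : onth w (p + q) = onth (drop p w) q.
    by rewrite -{1}(cat_take_drop p w) onth_cat size_take pw ltnNge leq_addr addKn.
  rewrite -[in RHS](addn0 p) -addnS !onthD.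
  case E: (drop p w) => [|x [|y s]] /=.
  - by move: (congr1 size E); rewrite size_drop /=; lia.
  - rewrite andbF; apply: contraNF hw => /eqP[_].
    by case: (w) (p) => [|z w'] [|p'] //= [->].
  - by rewrite take0 !eqseq_cons eqxx andbT.
have e : {in iota 0 (size w),
    preim (rot^~ w) (fun r => take 2 r == [:: b; a])
    =1 (fun p => (onth w p == Some b) && (onth w p.+1 == Some a))}.
  by move=> p; rewrite mem_iota add0n => /andP[_ /eP].
rewrite (eq_in_filter e).
apply/eq_in_map => p; rewrite mem_filter => /andP[/andP[_ h] _] /=.
have : isSome (onth w p.+1) by move/eqP: h => ->.
rewrite onthTE /rot => pw; rewrite drop_cat_le ?size_drop ?drop_drop //; lia.
Qed.

Lemma cyc_der2E b a (S : potential K Q) T :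
  cyc_equiv S T ->
  (forall w, T w != 0 -> cyclic_path w && (ohead w != Some a)) ->
  cyc_der2 b a S =1 cyc_der2_raw b a T.
Proof.
move=> ST hT v.
have raw U : (forall w, U w != 0 -> cyclic_path w && (ohead w != Some a)) ->
    cyc_der2_raw b a U v = lin_ext (cyc2_word b a) U v.
  move=> hU; rewrite /cyc_der2_raw (lin_extE _ _ (@size_cyc_der2_word b a)).
  rewrite (lin_extE _ _ (@size_cyc2_word b a)); apply: eq_bigr => w _.
  have [->|/hU/andP[_ h]] := eqVneq (U w) 0; first by rewrite !mul0rn.
  by rewrite cyc2_wordE.
rewrite /cyc_der2 !raw //; last exact: rot_off_supp.
apply: (lin_ext_cyc_equiv _ (@size_cyc2_word b a) (@rot_cyc2_word b a)).
exact: (cyc_equiv_trans (cyc_equiv_sym (rot_off_cyc_equiv a S)) ST).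
Qed.

End Series.

Record quiver_rep (K : fieldType) (Q : quiver) := QuiverRep {
  rep_sp : 'I_(nvert Q) -> vectType K;
  rep_map : forall a : arrow Q, 'Hom(rep_sp (tl a), rep_sp (hd a)) }.

Section Representations.
Variables (K : fieldType) (Q : quiver).
Implicit Types M N : quiver_rep K Q.

(* The identity if i = j, and 0 otherwise. *)
Definition eq_map M (i j : 'I_(nvert Q)) : 'Hom(rep_sp M i, rep_sp M j) :=
  match i =P j with
  | ReflectT e => ecast z 'Hom(rep_sp M i, rep_sp M z) e \1%VF
  | ReflectF _ => 0
  end.

Lemma eq_map_id M i : eq_map M i i = \1%VF.
Proof. by rewrite /eq_map; case: eqP => // e; rewrite (eq_axiomK e). Qed.

Lemma eq_map_neq M i j : i != j -> eq_map M i j = 0.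
Proof. by rewrite /eq_map; case: eqP. Qed.

(* The component M(i) -> M(j) of the action of a word: the composite of the maps
   of its letters if it is a path from i to j, and 0 otherwise. *)
Fixpoint word_map M (w : seq (arrow Q)) (i j : 'I_(nvert Q)) :
    'Hom(rep_sp M i, rep_sp M j) :=
  match w with
  | [::] => eq_map M i j
  | a :: w' => (eq_map M (hd a) j \o rep_map M a \o word_map M w' i (tl a))%VF
  end.

(* The component M(i) -> M(j) of u_M.  The sum has finite support as soon as all
   sufficiently long paths annihilate M. *)
Definition act M (u : series K Q) (i j : 'I_(nvert Q)) :
    'Hom(rep_sp M i, rep_sp M j) :=
  \sum_(w \in [set: seq (arrow Q)]) u w *: word_map M w i j.

Definition nilpotent_rep M : Prop :=
  exists N : nat, forall w, (N <= size w)%N -> forall i j, word_map M w i j = 0.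

Definition hom_defect_fun M N
    (f : dsum (fun i => hom_space (rep_sp M i) (rep_sp N i))) :
    dsum (fun a => hom_space (rep_sp M (tl a)) (rep_sp N (hd a))) :=
  mk_dsum (fun a => (rep_map N a \o dsum_fun f (tl a))%VF
                    - (dsum_fun f (hd a) \o rep_map M a)%VF).

(* Its elements are characterized by mem_homQ below. *)
Definition homQ M N := lker (linfun (@hom_defect_fun M N)).

Fact hom_defect_linear M N : linear (@hom_defect_fun M N).
Proof.
apply: dsum_linear => c f g a; rewrite !mk_dsumE.
rewrite comp_lfunDl comp_lfunDr -comp_lfunZl -comp_lfunZr scalerBr.
by rewrite opprD addrACA.
Qed.
HB.instance Definition _ M N := GRing.isLinear.Build K _ _ _
  (@hom_defect_fun M N) (@hom_defect_linear M N).

Lemma mem_homQ M N f : reflect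
  (forall a, (rep_map N a \o dsum_fun f (tl a))%VF
             = (dsum_fun f (hd a) \o rep_map M a)%VF)
  (f \in homQ M N).
Proof.
rewrite memv_ker lfunE /=; apply: (iffP eqP) => [h a|h].
  have: dsum_fun (hom_defect_fun f) a = 0 by rewrite h dsum_fun0.
  by rewrite mk_dsumE => /eqP; rewrite subr_eq0 => /eqP.
by apply/dsumP => a; rewrite mk_dsumE h subrr dsum_fun0.
Qed.

Definition in_arrow (k : 'I_(nvert Q)) : finType := {a : arrow Q | hd a == k}.
Definition out_arrow (k : 'I_(nvert Q)) : finType := {b : arrow Q | tl b == k}.

Definition M_in M k := dsum (fun a : in_arrow k => rep_sp M (tl (val a))).
Definition M_out M k := dsum (fun b : out_arrow k => rep_sp M (hd (val b))).

Definition gamma_fun M (S : series K Q) k (x : M_out M k) : M_in M k :=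
  mk_dsum (fun a : in_arrow k => \sum_(b : out_arrow k)
    act M (cyc_der2 (val b) (val a) S) (hd (val b)) (tl (val a)) (dsum_fun x b)).

Fact gamma_linear M S k : linear (@gamma_fun M S k).
Proof.
apply: dsum_linear => c x y a; rewrite !mk_dsumE scaler_sumr -big_split /=.
by apply: eq_bigr => b _; rewrite dsum_fun_linear linearP.
Qed.
HB.instance Definition _ M S k := GRing.isLinear.Build K _ _ _
  (@gamma_fun M S k) (@gamma_linear M S k).

Definition gamma M S k : 'Hom(M_out M k, M_in M k) := linfun (@gamma_fun M S k).

End Representations.

Record qp_rep (K : fieldType) (Q : quiver) (S : potential K Q) := QPRep {
  qp_under :> quiver_rep K Q;
  qp_dec : 'I_(nvert Q) -> vectType K;
  qp_nilp : nilpotent_rep qp_under;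
  qp_rel : forall a, act qp_under (cyc_der a S) (hd a) (tl a) = 0 }.

Section EInvariant.
Variables (K : fieldType) (Q : quiver) (S : potential K Q).

Definition g_vec (M : qp_rep S) (k : 'I_(nvert Q)) : int :=
  (\dim (lker (gamma M S k)))%:Z - (dim (rep_sp M k))%:Z + (dim (qp_dec M k))%:Z.

Definition E_inv (M : qp_rep S) : int :=
  (\dim (homQ M M))%:Z + \sum_(k < nvert Q) g_vec M k * (dim (rep_sp M k))%:Z.

End EInvariant.

Fact op_no_loop (Q : quiver) (a : arrow Q) : tl a != hd a.
Proof. by rewrite eq_sym no_loop. Qed.

Definition op_quiver (Q : quiver) : quiver := Quiver (@op_no_loop Q).

(* The arrow a^op of the opposite quiver is represented by a itself, so that the
   anti-isomorphism u |-> u^op reverses words. *)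
Definition op_series (K : fieldType) (Q : quiver) (S : series K Q) :
  series K (op_quiver Q) := fun w => S (rev w).

Fact op_pot_cyclic (K : fieldType) (Q : quiver) (S : potential K Q) w :
  op_series S w != 0 -> cyclic_path (w : seq (arrow (op_quiver Q))).
Proof.
move=> /pot_cyclic; rewrite /cyclic_path -!size_eq0 size_rev rev_cycle.
have -> // : @composable (op_quiver Q) = fun b a => @composable Q a b.
by apply/funext => a; apply/funext => b; rewrite /composable eq_sym.
Qed.

Definition op_pot (K : fieldType) (Q : quiver) (S : potential K Q) :
  potential K (op_quiver Q) := Potential (@op_pot_cyclic K Q S).

Definition dual_space (K : fieldType) (V : vectType K) : vectType K :=
  hom_space V K^o.

Definition dual_map (K : fieldType) (V W : vectType K) (f : 'Hom(V, W)) :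
    'Hom(dual_space W, dual_space V) :=
  linfun (fun phi : dual_space W => (phi \o f)%VF : dual_space V).

Section DualMap.
Variables (K : fieldType).
Implicit Types U V W : vectType K.

Fact precomp_linear V W (f : 'Hom(V, W)) :
  linear (fun phi : dual_space W => (phi \o f)%VF : dual_space V).
Proof. by move=> c x y; rewrite comp_lfunDl -comp_lfunZl. Qed.

Lemma dual_mapE V W (f : 'Hom(V, W)) (phi : dual_space W) :
  dual_map f phi = (phi \o f)%VF.
Proof.
pose F := GRing.isLinear.Build K _ _ _ _ (@precomp_linear V W f).
pose L : {linear dual_space W -> dual_space V} := HB.pack (fun phi => (phi \o f)%VF) F.
exact: (lfunE L).
Qed.

Lemma dual_map_comp U V W (f : 'Hom(V, W)) (g : 'Hom(U, V)) :
  dual_map (f \o g) = (dual_map g \o dual_map f)%VF.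
Proof. by apply/lfunP => x; rewrite comp_lfunE !dual_mapE comp_lfunA. Qed.

Lemma dual_map1 V : dual_map \1%VF = \1%VF :> 'Hom(dual_space V, dual_space V).
Proof. by apply/lfunP => x; rewrite dual_mapE id_lfunE comp_lfun1r. Qed.

Lemma dual_map0 V W : dual_map (0 : 'Hom(V, W)) = 0.
Proof. by apply/lfunP => x; rewrite dual_mapE comp_lfun0r zero_lfunE. Qed.

Lemma dual_mapD V W (f g : 'Hom(V, W)) :
  dual_map (f + g) = dual_map f + dual_map g.
Proof. by apply/lfunP => x; rewrite add_lfunE !dual_mapE comp_lfunDr. Qed.

Lemma dual_mapZ V W c (f : 'Hom(V, W)) : dual_map (c *: f) = c *: dual_map f.
Proof. by apply/lfunP => x; rewrite scale_lfunE !dual_mapE -comp_lfunZr. Qed.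

End DualMap.

Definition dual_quiver_rep (K : fieldType) (Q : quiver) (M : quiver_rep K Q) :
    quiver_rep K (op_quiver Q) :=
  @QuiverRep K (op_quiver Q) (fun k => dual_space (rep_sp M k))
    (fun a => dual_map (rep_map M a)).

Section Dual.
Variables (K : fieldType) (Q : quiver).
Implicit Types (M : quiver_rep K Q) (i j : 'I_(nvert Q)).
Local Notation "M ^*" := (dual_quiver_rep M).

Lemma dual_eq_map M i j : eq_map (M^*) i j = dual_map (eq_map M j i).
Proof.
have [->|ij] := eqVneq i j.
  rewrite (eq_map_id M j) dual_map1.
  exact: (@eq_map_id K (op_quiver Q) (M^*)).
rewrite (@eq_map_neq _ _ M) 1?eq_sym // dual_map0.
exact: (@eq_map_neq K (op_quiver Q) (M^*)).
Qed.

Lemma word_map_cat1 M w a i j : word_map M (rcons w a) i j =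
  (word_map M w (hd a) j \o rep_map M a \o eq_map M i (tl a))%VF.
Proof.
elim: w j => [|b w IH] j //=.
by rewrite IH !comp_lfunA.
Qed.

Lemma dual_word_map M (w : seq (arrow Q)) i j :
  word_map (M^*) w i j = dual_map (word_map M (rev w) j i).
Proof.
elim: w i j => [|a w IH] i j; first exact: dual_eq_map.
rewrite rev_cons word_map_cat1 !dual_map_comp /= IH dual_eq_map /=.
by rewrite comp_lfunA.
Qed.

Lemma nilpotent_dual M : nilpotent_rep M -> nilpotent_rep (M^*).
Proof.
case=> N hN; exists N => w Nw i j.
by rewrite dual_word_map hN ?size_rev // dual_map0.
Qed.

Lemma dual_act M (u : series K Q) i j : nilpotent_rep M ->
  act (M^*) (op_series u) i j = dual_map (act M u j i).
Proof.
case=> N hN; rewrite /act.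
rewrite (reindex_fsbigT (@rev (arrow Q))); last by exists rev; exact: revK.
under eq_fsbigr => w _ do rewrite /op_series revK dual_word_map revK -dual_mapZ.
pose r := undup (flatten [seq [seq val t | t : n.-tuple (arrow Q)] | n <- iota 0 N]).
have memr w : (size w < N)%N -> w \in r.
  move=> wN; rewrite mem_undup; apply/flatten_mapP; exists (size w).
    by rewrite mem_iota.
  by apply/mapP; exists (in_tuple w); rewrite ?mem_enum.
have out w : ~ w \in r -> word_map M w j i = 0.
  by move=> wr; apply: hN; rewrite leqNgt; apply/negP => /memr.
rewrite -(@fsbig_widen _ _ _ _ [set` r]) //; last first.
  by move=> w [_ /= /out ->]; rewrite scaler0 dual_map0.
rewrite -[in RHS](@fsbig_widen _ _ _ _ [set` r]) //; last first.
  by move=> w [_ /= /out ->]; rewrite scaler0.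
rewrite -!fsbig_seq ?undup_uniq //.
by rewrite (big_morph _ (@dual_mapD _ _ _) (@dual_map0 _ _ _)).
Qed.

Lemma cyc_der_word_rev a (w : seq (arrow Q)) :
  perm_eq (cyc_der_word a (rev w)) [seq rev v | v <- cyc_der_word a w].
Proof.
rewrite /cyc_der_word size_rev.
pose g p := (size w - p.+1)%N.
have gE : [seq g p | p <- iota 0 (size w)] = rev (iota 0 (size w)).
  apply: (@eq_from_nth _ 0%N) => [|p]; rewrite size_map size_iota ?size_rev ?size_iota // => pw.
  by rewrite (nth_map 0%N) ?size_iota // nth_rev ?size_iota // !nth_iota ?size_iota /g; lia.
apply: (perm_trans (perm_map _ (perm_filter _ (_ : perm_eq _ (map g (iota 0 (size w))))))).
  by rewrite gE perm_sym perm_rev.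
rewrite filter_map -!map_comp.
have e : {in iota 0 (size w), preim g (fun p => onth (rev w) p == Some a)
                              =1 (fun p => onth w p == Some a)}.
  move=> p; rewrite mem_iota add0n => /andP[_ pw] /=.
  rewrite !onthE map_rev nth_rev size_map /g; last by lia.
  by rewrite (_ : (size w - _)%N = p) //; lia.
rewrite (eq_in_filter e).
set r := filter _ _.
suff -> : [seq ((fun p => drop p.+1 (rev w) ++ take p (rev w)) \o g) p | p <- r]
        = [seq rev (drop p.+1 w ++ take p w) | p <- r] by [].
apply/eq_in_map => p; rewrite mem_filter mem_iota add0n => /and3P[_ _ pw] /=.
rewrite rev_cat drop_rev take_rev /g; congr (rev (take _ w) ++ rev (drop _ w)); lia.
Qed.

Lemma cyc_der_op a (S : series K Q) :
  cyc_der (a : arrow (op_quiver Q)) (op_series S) = op_series (cyc_der a S).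
Proof.
apply/funext => v; rewrite /cyc_der /op_series /lin_ext.
rewrite (reindex_fsbigT (@rev (arrow Q))); last by exists rev; exact: revK.
apply: eq_fsbigr => w _; rewrite revK; congr (_ *+ _).
rewrite (permP (cyc_der_word_rev a w)) count_map.
by apply: eq_count => u /=; rewrite (can2_eq revK revK).
Qed.

Fact dual_rel (S : potential K Q) (M : qp_rep S) (a : arrow (op_quiver Q)) :
  act (dual_quiver_rep M) (cyc_der a (op_pot S)) (hd a) (tl a) = 0.
Proof.
rewrite [cyc_der _ _](cyc_der_op a S) (@dual_act _ _ _ _ (qp_nilp M)).
by rewrite (@qp_rel _ _ _ M a) dual_map0.
Qed.

End Dual.

Definition dual_rep (K : fieldType) (Q : quiver) (S : potential K Q)
    (M : qp_rep S) : qp_rep (op_pot S) :=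
  @QPRep K (op_quiver Q) (op_pot S) (dual_quiver_rep M) (qp_dec M)
    (nilpotent_dual (qp_nilp M)) (dual_rel M).

(* Main.v *)
(* Writing dim ker gamma_k = dim M_out(k) - rank gamma_k, the E-invariant splits
   into dim Hom(M, M), the sums of (dim V(k) - dim M(k)) dim M(k) and of
   - rank gamma_k dim M(k), and the sum of dim M_out(k) dim M(k), which counts
   dim M(t(a)) dim M(h(a)) over all arrows a and so does not change when
   M_out(k) is replaced by M_in(k).  Every term is thus invariant under duality:
   transposition identifies Hom(M, M) with Hom(M', M') for the dual M', and
   gamma_k of the dual is the dual of gamma_k, because
   d_(a^op b^op)(S^op) = (d_(b a) S)^op. *)
From HB Require Import structures.
Require Import Defs.
From mathcomp Require Import all_boot all_order all_algebra.
From mathcomp Require Import boolp fsbigop reals complex zify.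

Set Implicit Arguments.
Unset Strict Implicit.
Unset Printing Implicit Defensive.

Import GRing.Theory.
Local Open Scope ring_scope.

(** * Reversal of words and second cyclic derivatives *)

Section Rotations.
Variable T : eqType.
Implicit Types v w : seq T.

Definition rotations w := [seq rot p w | p <- iota 0 (size w)].

(** [rot 1] shifts the exponents 0, ..., n - 1 to 1, ..., n, and rotation by n is rotation by 0. *)
Lemma rotations_rot1 w : perm_eq (rotations w) [seq rot 1 r | r <- rotations w].
Proof.
rewrite /rotations -map_comp.
have -> : [seq (rot 1 \o rot^~ w) p | p <- iota 0 (size w)]
        = [seq rot p w | p <- iota 1 (size w)].
  rewrite (iotaDl 1 0) -map_comp; apply/eq_in_map => p.
  by rewrite mem_iota /= => pw; rewrite -rotD.
have e : rot 0 w = rot (size w) w by rewrite rot0 rot_size.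
case: (size w) e => // m e.
have -> : iota 1 m.+1 = iota 1 m ++ [:: m.+1] by rewrite -[in LHS](addn1 m) iotaD.
by rewrite map_cat perm_sym perm_catC /= e.
Qed.

(** Reversal turns rotation by p into rotation by n - p; the exponent n, coming from p = 0, counts
    as 0. *)
Lemma rotations_rev w : perm_eq (rotations (rev w)) [seq rev r | r <- rotations w].
Proof.
rewrite /rotations size_rev -map_comp.
set n := size w.
have -> : [seq (rev \o rot^~ w) p | p <- iota 0 n]
        = [seq rot p (rev w) | p <- [seq (n - p)%N | p <- iota 0 n]].
  rewrite -map_comp; apply/eq_map => p /=.
  by rewrite rev_rot /rotr size_rev.
have e : rot 0 (rev w) = rot n (rev w) by rewrite rot0 /n -size_rev rot_size.
case: n e => // m e.
rewrite [iota 0 m.+1]/= /= subn0 e perm_cons; apply: perm_map.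
suff -> : [seq (m.+1 - p)%N | p <- iota 1 m] = rev (iota 1 m) by rewrite perm_sym perm_rev.
apply: (@eq_from_nth _ 0%N) => [|p]; rewrite size_map size_iota ?size_rev ?size_iota // => pw.
by rewrite (nth_map 0%N) ?size_iota // nth_rev ?size_iota // !nth_iota ?size_iota; lia.
Qed.

End Rotations.

(* A rotation of w starting with b a corresponds, after rotating twice and
   reversing, to a rotation of rev w starting with a b. *)
Lemma cyc2_word_rev (Q : quiver) (a b : arrow Q) (w : seq (arrow Q)) :
  perm_eq (@cyc2_word (op_quiver Q) a b (rev w)) [seq rev v | v <- cyc2_word b a w].
Proof.
pose rr (r : seq (arrow Q)) := rot 1 (rot 1 r).
have rrE x y s : rev (rr [:: x, y & s]) = [:: y, x & rev s].
  by rewrite /rr rot1_cons rcons_cons rot1_cons !rev_rcons.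
have rrP : perm_eq (rotations w) [seq rr r | r <- rotations w].
  apply: (perm_trans (rotations_rot1 w)).
  by rewrite /rr (map_comp (rot 1) (rot 1)); apply/perm_map/rotations_rot1.
rewrite /cyc2_word -!/(rotations _) -map_comp.
apply: (perm_trans (perm_map _ (perm_filter _ (perm_trans (rotations_rev w) (perm_map _ rrP))))).
rewrite -map_comp filter_map -map_comp.
have e : preim (rev \o rr) (fun r => take 2 r == [:: a; b])
         =1 (fun r => take 2 r == [:: b; a]).
  move=> [|x [|y s]] //; first by rewrite /= !eqseq_cons !andbF.
  rewrite [LHS](_ : _ = (take 2 (rev (rr [:: x, y & s])) == [:: a; b])) //.
  by rewrite rrE /= !take0 !eqseq_cons andbCA.
rewrite (eq_filter e).
set l := filter _ _.
suff -> : [seq (drop 2 \o (rev \o rr)) r | r <- l] = [seq (rev \o drop 2) r | r <- l] by [].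
apply/eq_in_map => -[|x [|y s]]; rewrite mem_filter // => _.
by rewrite /comp rrE /= !drop0.
Qed.

(** Up to permutation, [cyc2_word] does not change when its argument is rotated. So S may be
    replaced by [rot_off a S], on whose support no word starts with a and [cyc2_word] agrees with
    [cyc_der2_word]. This form involves no choice of representative, which suits reversal. *)
Lemma cyc_der2_cyc2 (K : fieldType) (Q : quiver) b a (S : potential K Q) :
  cyc_der2 b a S = lin_ext (cyc2_word b a) S.
Proof.
apply/funext => v.
rewrite -[RHS](lin_ext_cyc_equiv v (@size_cyc2_word Q b a) (@rot_cyc2_word Q b a)
  (cyc_equiv_sym (rot_off_cyc_equiv a S))).
rewrite /cyc_der2 /cyc_der2_raw (lin_extE _ _ (@size_cyc_der2_word Q b a)).
rewrite (lin_extE _ _ (@size_cyc2_word Q b a)); apply: eq_bigr => w _.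
have [->|/rot_off_supp/andP[_ h]] := eqVneq (rot_off a S w) 0; first by rewrite !mul0rn.
by rewrite cyc2_wordE.
Qed.

Lemma cyc_der2_op (K : fieldType) (Q : quiver) (b a : arrow Q) (S : potential K Q) :
  @cyc_der2 K (op_quiver Q) a b (op_pot S) = op_series (cyc_der2 b a S).
Proof.
rewrite (cyc_der2_cyc2 (Q := op_quiver Q)) (cyc_der2_cyc2 b a S).
apply/funext => v; rewrite /op_series /lin_ext.
rewrite (reindex_fsbigT (@rev (arrow Q))); last by exists rev; exact: revK.
apply: eq_fsbigr => w _; rewrite /= /op_series revK; congr (_ *+ _).
rewrite (permP (cyc2_word_rev a b w)) count_map.
by apply: eq_count => u /=; rewrite (can2_eq revK revK).
Qed.

(** * Dimension counts and ranks of dual maps *)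

Section Dimensions.
Variable K : fieldType.
Implicit Types U V W : vectType K.

(** Injectivity and equal dimensions make L bijective, so that it maps A onto B; no inverse has to
    be constructed in the applications. *)
Lemma dim_eq_inj V W (A : {vspace V}) (B : {vspace W}) (L : {linear V -> W}) :
  injective L -> dim V = dim W -> (forall x, (x \in A) = (L x \in B)) ->
  \dim A = \dim B.
Proof.
move=> injL dVW AB.
have k0 : lker (linfun L) == 0%VS.
  by apply/lker0P => x y; rewrite !lfunE; apply: injL.
have full : limg (linfun L) = fullv.
  apply/eqP; rewrite eqEdim subvf /= !limg_dim_eq ?(eqP k0) ?capv0 //.
  by rewrite !dimvf dVW.
rewrite -(@limg_dim_eq _ _ _ (linfun L) A) ?(eqP k0) ?capv0 //; congr (\dim _).
apply/vspaceP => y; apply/memv_imgP/idP => [[x xA ->]|yB].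
  by rewrite lfunE -AB.
have /memv_imgP[x _ yE] : y \in limg (linfun L) by rewrite full memvf.
by exists x => //; rewrite AB -[L x]lfunE -yE.
Qed.

Lemma dim_hom V W : dim (hom_space V W) = (dim V * dim W)%N.
Proof. by []. Qed.

Lemma dim_dual V : dim (dual_space V) = dim V.
Proof. exact: muln1. Qed.

Lemma dim_dsum (I : finType) (T : I -> vectType K) :
  dim (dsum T) = (\sum_i dim (T i))%N.
Proof. by rewrite (reindex _ (onW_bij _ (@enum_val_bij I))). Qed.

(** The coordinate forms of a basis already separate points. *)
Lemma dual_sep V (x : V) : (forall phi : dual_space V, phi x = 0) -> x = 0.
Proof.
move=> h; rewrite (coord_vbasis (memvf x)) big1 // => i _.
have := h (linfun (coord (vbasis fullv) i : V -> K^o)).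
by rewrite lfunE => ->; rewrite scale0r.
Qed.

End Dimensions.

Section DualMap.
Variable K : fieldType.
Implicit Types V W : vectType K.

Lemma dual_map_inj V W : injective (@dual_map K V W).
Proof.
move=> f g fg; apply/lfunP => x; apply/eqP; rewrite -subr_eq0; apply/eqP.
apply: dual_sep => phi; rewrite linearB /= -!comp_lfunE -!dual_mapE fg.
by rewrite subrr.
Qed.

Lemma limg_dual_dim V W (f : 'Hom(V, W)) : \dim (limg (dual_map f)) = \dim (limg f).
Proof.
(* f factors as an injection i, with left inverse q, after a surjection p, with
   section s. *)
pose U : vectType K := subvs_of (limg f).
pose i : 'Hom(U, W) := linfun vsval.
pose q : 'Hom(W, U) := linfun (vsproj (limg f)).
pose p : 'Hom(V, U) := (q \o f)%VF.
pose s : 'Hom(U, V) := (f^-1 \o i)%VF.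
have qi : (q \o i = \1)%VF.
  by apply/lfunP => x; rewrite comp_lfunE !lfunE /= vsvalK.
have fE : f = (i \o p)%VF.
  apply/lfunP => x; rewrite !comp_lfunE !lfunE /= vsprojK //.
  exact: memv_img (memvf _).
have ps : (p \o s = \1)%VF.
  rewrite -qi /p -comp_lfunA; congr (_ \o _)%VF; apply/lfunP => x.
  rewrite !comp_lfunE limg_lfunVK // !lfunE; exact: subvsP.
(* Dualizing [q \o i = \1] gives the dual of i a right inverse, and dualizing [p \o s = \1] gives
   the dual of p a left inverse; the image of the dual of f thus has the dimension of U. *)
have i_onto : limg (dual_map i) = fullv.
  apply/eqP; rewrite eqEsubv subvf /= -(lim1g fullv) -dual_map1 -qi dual_map_comp.
  by rewrite limg_comp limgS ?subvf.
have p_inj : lker (dual_map p) = 0%VS.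
  apply/eqP/lker0P; apply: (can_inj (g := dual_map s)) => x.
  by rewrite -comp_lfunE -dual_map_comp ps dual_map1 id_lfunE.
rewrite {1}fE dual_map_comp limg_comp i_onto limg_dim_eq ?p_inj ?capv0 //.
by rewrite dimvf dim_dual.
Qed.

End DualMap.

(** * Duals of direct sums and of block matrices *)

Section DualBlocks.
Variables (K : fieldType) (I : finType) (T : I -> vectType K).

(** Inclusion of a summand. [T i] and [T j] are different types, so x is transported along a proof
    of i = j. *)
Definition dsum_inj_fun i (x : T i) : dsum T :=
  mk_dsum (fun j => match i =P j with
                    | ReflectT e => ecast z (T z) e x
                    | ReflectF _ => 0
                    end).

Lemma dsum_inj_id i (x : T i) : dsum_fun (dsum_inj_fun x) i = x.
Proof. by rewrite mk_dsumE; case: eqP => // e; rewrite (eq_axiomK e). Qed.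

Lemma dsum_inj_neq i j (x : T i) : i != j -> dsum_fun (dsum_inj_fun x) j = 0.
Proof. by rewrite mk_dsumE; case: eqP. Qed.

Fact dsum_inj_linear i : linear (@dsum_inj_fun i).
Proof.
apply: dsum_linear => c x y j; have [<-|ij] := eqVneq i j.
  by rewrite !dsum_inj_id.
by rewrite !dsum_inj_neq // scaler0 addr0.
Qed.
HB.instance Definition _ i :=
  GRing.isLinear.Build K _ _ _ (@dsum_inj_fun i) (@dsum_inj_linear i).

Definition dsum_inj i : 'Hom(T i, dsum T) := linfun (@dsum_inj_fun i).

Lemma dsum_injE i x : dsum_inj i x = dsum_inj_fun x.
Proof. exact: lfunE. Qed.

Lemma dsum_fun_sum (J : finType) (F : J -> dsum T) i :
  dsum_fun (\sum_j F j) i = \sum_j dsum_fun (F j) i.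
Proof.
exact: (big_morph (fun x : dsum T => dsum_fun x i) (fun x y => dsum_funD x y i)
  (dsum_fun0 T i)).
Qed.

Lemma dsum_decomp (x : dsum T) : x = \sum_i dsum_inj i (dsum_fun x i).
Proof.
apply/dsumP => j; rewrite dsum_fun_sum (bigD1 j) //= dsum_injE dsum_inj_id.
by rewrite big1 ?addr0 // => i ij; rewrite dsum_injE dsum_inj_neq.
Qed.

(** The canonical isomorphism from the dual of a direct sum to the direct sum of the duals: a form
    is restricted to each summand. *)
Definition dual_blocks_fun (phi : dual_space (dsum T)) :
    dsum (fun i => dual_space (T i)) :=
  mk_dsum (fun i => dual_map (dsum_inj i) phi).

Fact dual_blocks_linear : linear dual_blocks_fun.
Proof. by apply: dsum_linear => c x y i; rewrite !mk_dsumE linearP. Qed.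
HB.instance Definition _ :=
  GRing.isLinear.Build K _ _ _ dual_blocks_fun dual_blocks_linear.

Lemma dual_blocks_inj : injective dual_blocks_fun.
Proof.
move=> f g fg; apply/lfunP => x; rewrite (dsum_decomp x) !linear_sum.
apply: eq_bigr => i _.
have /lfunP/(_ (dsum_fun x i)) := congr1 (fun h => dsum_fun h i : 'Hom(T i, K^o)) fg.
by rewrite /= !mk_dsumE !dual_mapE !comp_lfunE.
Qed.

Lemma dim_dual_blocks :
  dim (dual_space (dsum T)) = dim (dsum (fun i => dual_space (T i))).
Proof. by rewrite dim_dual !dim_dsum; apply: eq_bigr => i _; rewrite dim_dual. Qed.

End DualBlocks.

(** B has the blocks [f i j] and B' the transposed dual blocks. The restriction isomorphisms carry
    the dual of B to B', hence the kernel of one onto that of the other. *)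
Lemma dim_lker_block_dual (K : fieldType) (I J : finType)
    (T : I -> vectType K) (U : J -> vectType K) (f : forall i j, 'Hom(T i, U j))
    (B : 'Hom(dsum T, dsum U))
    (B' : 'Hom(dsum (fun j => dual_space (U j)), dsum (fun i => dual_space (T i)))) :
  (forall x j, dsum_fun (B x) j = \sum_i f i j (dsum_fun x i)) ->
  (forall y i, dsum_fun (B' y) i = \sum_j dual_map (f i j) (dsum_fun y j)) ->
  \dim (lker B') = \dim (lker (dual_map B)).
Proof.
move=> BE B'E.
have comm phi : B' (dual_blocks_fun phi) = dual_blocks_fun (dual_map B phi).
  apply/dsumP => i; rewrite B'E !mk_dsumE !dual_mapE.
  apply/lfunP => x; rewrite sum_lfunE !comp_lfunE [B _]dsum_decomp linear_sum.
  apply: eq_bigr => j _; rewrite !mk_dsumE !dual_mapE !comp_lfunE BE.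
  congr (phi (dsum_inj _ j _)).
  (* Restricting to the summand i leaves only the block [f i j]. *)
  rewrite (bigD1 i) //= dsum_injE dsum_inj_id big1 ?addr0 // => i' ii'.
  by rewrite dsum_inj_neq ?linear0 // eq_sym.
apply/esym/(dim_eq_inj (@dual_blocks_inj _ _ U) (dim_dual_blocks U)) => phi.
by rewrite !memv_ker comm -[X in _ = (_ == X)](linear0 (@dual_blocks_fun _ _ T))
  (inj_eq (@dual_blocks_inj _ _ T)).
Qed.

(** * Duality for the terms of the E-invariant *)

Lemma sum_fiber (I J : finType) (f : I -> J) (j : J) (F : I -> nat) :
  (\sum_(i | f i == j) F i = \sum_(i : {i | f i == j}) F (val i))%N.
Proof. exact: (big_sub [pred i | f i == j]). Qed.

Section EInvariantDual.
Variables (K : fieldType) (Q : quiver).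

(** Componentwise transposition is injective, and since [dual_map] is injective, a family commutes
    with the arrow maps iff its transpose commutes with the dual ones. *)
Lemma dim_homQ_dual (M : quiver_rep K Q) :
  \dim (homQ (dual_quiver_rep M) (dual_quiver_rep M)) = \dim (homQ M M).
Proof.
pose D (f : dsum (fun i => hom_space (rep_sp M i) (rep_sp M i))) :
    dsum (fun i => hom_space (dual_space (rep_sp M i)) (dual_space (rep_sp M i))) :=
  mk_dsum (fun i => dual_map (dsum_fun f i)).
have Dl : linear D.
  by apply: dsum_linear => c f g i; rewrite !mk_dsumE dual_mapD dual_mapZ.
pose F := GRing.isLinear.Build K _ _ _ D Dl.
pose L : {linear _ -> _} := HB.pack D F.
apply/esym/(@dim_eq_inj _ _ _ _ _ L).
- move=> f g fg; apply/dsumP => i; apply: dual_map_inj.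
  by have := congr1 (fun h => dsum_fun h i) fg; rewrite /= /D !mk_dsumE.
- by rewrite !dim_dsum; apply: eq_bigr => i _; rewrite !dim_hom !muln1.
- move=> f; pose N := dual_quiver_rep M.
  have DfP : reflect _ (D f \in homQ N N) := @mem_homQ K (op_quiver Q) N N (D f).
  apply: (sameP (mem_homQ f)); apply: (iffP DfP) => h a.
    by have := h a; rewrite /= /D !mk_dsumE -!dual_map_comp => /dual_map_inj.
  by rewrite /= /D !mk_dsumE -!dual_map_comp h.
Qed.

Lemma dim_lker_gamma_dual (S : potential K Q) (M : quiver_rep K Q) (k : 'I_(nvert Q)) :
  nilpotent_rep M ->
  \dim (lker (gamma (dual_quiver_rep M) (op_pot S) k)) =
  \dim (lker (dual_map (gamma M S k))).
Proof.
move=> nM.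
pose f (b : out_arrow k) (a : in_arrow k) :=
  act M (cyc_der2 (val b) (val a) S) (hd (val b)) (tl (val a)).
(* By conversion, [M_out] and [M_in] of the dual are the sums of dual spaces over [in_arrow k] and
   [out_arrow k]. *)
apply: (@dim_lker_block_dual _ _ _ _ _ f) => [x a|y b].
  by rewrite lfunE mk_dsumE.
pose N := dual_quiver_rep M.
have gE (z : M_out N k) : gamma N (op_pot S) k z = gamma_fun (op_pot S) z.
  exact: lfunE.
rewrite [X in dsum_fun X b](gE y) mk_dsumE; apply: eq_bigr => a _.
by rewrite [cyc_der2 _ _ _](@cyc_der2_op K Q (val b) (val a) S) (@dual_act _ _ _ _ _ _ nM).
Qed.

(** Rank-nullity for gamma_k and its dual, which have the same rank; the additive form avoids
    subtraction of natural numbers. *)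
Lemma dim_lker_gamma_op (S : potential K Q) (M : quiver_rep K Q) (k : 'I_(nvert Q)) :
  nilpotent_rep M ->
  (\dim (lker (gamma (dual_quiver_rep M) (op_pot S) k)) + dim (M_out M k) =
   \dim (lker (gamma M S k)) + dim (M_in M k))%N.
Proof.
move=> nM; rewrite (dim_lker_gamma_dual S k nM).
have := limg_ker_dim (gamma M S k) fullv.
have := limg_ker_dim (dual_map (gamma M S k)) fullv.
rewrite !capfv !dimvf limg_dual_dim dim_dual => e e'.
by rewrite -[dim (M_in M k)]e -[dim (M_out M k)]e' addnCA.
Qed.

(** Each arrow is counted at its head k; [sum_fiber] passes to the subtype [in_arrow k]. *)
Lemma sum_dim_M_in (M : quiver_rep K Q) :
  (\sum_k dim (M_in M k) * dim (rep_sp M k) =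
   \sum_a dim (rep_sp M (tl a)) * dim (rep_sp M (hd a)))%N.
Proof.
rewrite (partition_big (@hd Q) predT) //=; apply: eq_bigr => k _.
rewrite dim_dsum big_distrl /= sum_fiber.
by apply: eq_bigr => -[a /eqP /= ->] _.
Qed.

Lemma sum_dim_M_out (M : quiver_rep K Q) :
  (\sum_k dim (M_out M k) * dim (rep_sp M k) =
   \sum_a dim (rep_sp M (tl a)) * dim (rep_sp M (hd a)))%N.
Proof.
rewrite (partition_big (@tl Q) predT) //=; apply: eq_bigr => k _.
rewrite dim_dsum big_distrl /= sum_fiber.
by apply: eq_bigr => -[a /eqP /= ->] _; rewrite mulnC.
Qed.

End EInvariantDual.

Theorem proposition7p3 (R : realType) (Q : quiver) (S : potential R[i] Q)
    (M : qp_rep S) : E_inv (dual_rep M) = E_inv M.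
Proof.
rewrite /E_inv dim_homQ_dual; congr (_ + _).
apply/eqP; rewrite -subr_eq0 -sumrB; apply/eqP.
(* In g_k only the kernel dimension changes, by dim M_in(k) - dim M_out(k); weighted by dim M(k),
   these differences sum to zero. *)
transitivity (\sum_k ((dim (M_in M k) * dim (rep_sp M k))%N%:Z
                      - (dim (M_out M k) * dim (rep_sp M k))%N%:Z)); last first.
  rewrite sumrB -!(big_morph Posz PoszD (erefl (Posz 0))) sum_dim_M_in sum_dim_M_out.
  exact: subrr.
apply: eq_bigr => k _; rewrite /g_vec /= dim_dual.
have /(congr1 Posz) := dim_lker_gamma_op S k (qp_nilp M).
rewrite !PoszD !PoszM -mulrBl => e; rewrite -mulrBl; congr (_ * _).
(* Here x and z stand for the two kernel dimensions, y and t for dim M_out(k) and dim M_in(k). *)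
have arith (x y z t d v : int) : x + y = z + t -> x - d + v - (z - d + v) = t - y by lia.
exact: arith e.
Qed.
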